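(* Let $\mathcal S\colon\mathtt C\to\mathtt{FVec}$ be a stem. Every $\mathcal S$-system (on any finite-dimensional real vector space $X$) is a (possibly infinite) intersection of $\mathcal S$-hedra on $X$.
   Context: All vector spaces are finite-dimensional and real; $\mathtt{FVec}$ is the category of these with linear maps, $V'=\mathrm{Lin}(V,\mathbb R)$. A star autonomous category is a symmetric monoidal category $(\mathtt C,\otimes,\mathbf 1)$ with a full and faithful functor ${}^*\colon\mathtt C^{\mathrm{op}}\to\mathtt C$ and a natural bijection $\mathtt C(a\otimes b,c)\cong\mathtt C(a,(b\otimes c^* )^* )$. $\mathtt{FVec}$ is star autonomous with the usual tensor product and dual. A stem is a star autonomous functor $\mathcal S\colon\mathtt C\to\mathtt{FVec}$, where $\mathtt C$ is star autonomous: i.e. a strong monoidal functor with natural isomorphisms $\mathcal S(c^* )\cong\mathcal S(c)'$, such that $\mathcal S$ carries the bijection $\mathtt C(a\otimes b,c)\cong\mathtt C(a,(b\otimes c^* )^* )$ to the corresponding bijection in $\mathtt{FVec}$. These isomorphisms are written as equalities: $\mathcal S(\mathbf 1)=\mathbb R$, $\mathcal S(\mathbf 1^* )=\mathbb R'=\mathbb R$, $\mathcal S(c\otimes d)=\mathcal S(c)\otimes\mathcal S(d)$, $\mathcal S(c^* )=\mathcal S(c)'$. For $c\in\mathtt C$: $A(c)=\{v\in\mathcal S(c)\mid\mathcal S(\varphi)(v)\ge 0\ \forall\varphi\in\mathtt C(c,\mathbf 1^* )\}$. An $\mathcal S$-system $\mathcal G$ on $X$ is a family of closed convex cones $\mathcal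 G(c)\subseteq X\otimes\mathcal S(c)$, $c\in\mathtt C$, with $(\mathrm{id}_X\otimes\mathcal S(\Phi))(\mathcal G(c))\subseteq\mathcal G(d)$ for all $\Phi\in\mathtt C(c,d)$. Intersections are level-wise: $(\bigcap_i\mathcal G_i)(c)=\bigcap_i\mathcal G_i(c)$. The intrinsic system $\mathcal A_d$ on $\mathcal S(d)$ is $\mathcal A_d(c)=A(d\otimes c)\subseteq\mathcal S(d)\otimes\mathcal S(c)$. A system $\mathcal G$ on $X$ has a concrete realization if there are $d\in\mathtt C$ and a linear map $\Psi\colon X\to\mathcal S(d)$ with $\mathcal G=\Psi^{-1}(\mathcal A_d)$, i.e. $\mathcal G(c)=(\Psi\otimes\mathrm{id}_{\mathcal S(c)})^{-1}(A(d\otimes c))$ for all $c$. An $\mathcal S$-hedron is a finite intersection of systems with a concrete realization. *)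

(* Defs.v *)
From HB Require Import structures.
From mathcomp Require Import all_boot all_order all_algebra.
From mathcomp Require Import all_classical all_reals all_analysis.

Set Implicit Arguments.
Unset Strict Implicit.
Unset Printing Implicit Defensive.

Import Order.TTheory GRing.Theory Num.Theory numFieldNormedType.Exports.
Local Open Scope classical_set_scope.
Local Open Scope ring_scope.

Declare Scope cat_scope.
Delimit Scope cat_scope with cat.

Reserved Notation "a ~> b" (at level 65, no associativity).
Reserved Notation "g \oc f" (at level 50, left associativity).
Reserved Notation "a \ox b" (at level 40, left associativity).
Reserved Notation "f \oxm g" (at level 40, left associativity).

Record category := Category {
  Ob :> Type;
  Mor : Ob -> Ob -> Type;
  idm : forall a, Mor a a;
  compm : forall a b c, Mor b c -> Mor a b -> Mor a c;
  compmA : forall a b c d (h : Mor c d) (g : Mor b c) (f : Mor a b),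
    compm h (compm g f) = compm (compm h g) f;
  comp1m : forall a b (f : Mor a b), compm (idm b) f = f;
  compm1 : forall a b (f : Mor a b), compm f (idm a) = f }.

Arguments Mor {_} _ _.
Arguments idm {_} _.
Notation "a ~> b" := (Mor a b) : type_scope.
Notation "g \oc f" := (compm g f) : cat_scope.
Bind Scope cat_scope with Mor.
Bind Scope cat_scope with Ob.
Local Open Scope cat_scope.

Definition is_iso (C : category) (a b : C) (f : a ~> b) :=
  exists g : b ~> a, g \oc f = idm a /\ f \oc g = idm b.

Record sym_monoidal := SymMonoidal {
  smc_cat :> category;
  tens : smc_cat -> smc_cat -> smc_cat;
  tensm : forall a a' b b' : smc_cat,
    a ~> a' -> b ~> b' -> tens a b ~> tens a' b';
  tens_id : forall a b : smc_cat, tensm (idm a) (idm b) = idm (tens a b);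
  tens_comp : forall (a a' a'' b b' b'' : smc_cat)
      (f' : a' ~> a'') (f : a ~> a') (g' : b' ~> b'') (g : b ~> b'),
    tensm (f' \oc f) (g' \oc g) = tensm f' g' \oc tensm f g;
  one : smc_cat;
  assoc : forall a b c, tens (tens a b) c ~> tens a (tens b c);
  lunit : forall a, tens one a ~> a;
  runit : forall a, tens a one ~> a;
  braid : forall a b, tens a b ~> tens b a;
  assoc_iso : forall a b c, is_iso (assoc a b c);
  lunit_iso : forall a, is_iso (lunit a);
  runit_iso : forall a, is_iso (runit a);
  assoc_nat : forall (a a' b b' c c' : smc_cat)
      (f : a ~> a') (g : b ~> b') (h : c ~> c'),
    assoc a' b' c' \oc tensm (tensm f g) h
    = tensm f (tensm g h) \oc assoc a b c;
  lunit_nat : forall (a a' : smc_cat) (f : a ~> a'),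
    lunit a' \oc tensm (idm one) f = f \oc lunit a;
  runit_nat : forall (a a' : smc_cat) (f : a ~> a'),
    runit a' \oc tensm f (idm one) = f \oc runit a;
  braid_nat : forall (a a' b b' : smc_cat) (f : a ~> a') (g : b ~> b'),
    braid a' b' \oc tensm f g = tensm g f \oc braid a b;
  pentagon : forall a b c d,
    assoc a b (tens c d) \oc assoc (tens a b) c d
    = tensm (idm a) (assoc b c d) \oc assoc a (tens b c) d
      \oc tensm (assoc a b c) (idm d);
  triangle : forall a b,
    tensm (idm a) (lunit b) \oc assoc a one b = tensm (runit a) (idm b);
  hexagon : forall a b c,
    assoc b c a \oc braid a (tens b c) \oc assoc a b c
    = tensm (idm b) (braid a c) \oc assoc b a c
      \oc tensm (braid a b) (idm c);
  braid_sym : forall a b, braid b a \oc braid a b = idm (tens a b) }.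

Arguments one {_}.
Arguments lunit {_} _.
Arguments runit {_} _.
Notation "a \ox b" := (tens a b) : cat_scope.
Notation "f \oxm g" := (tensm f g) : cat_scope.

Record star_autonomous := StarAutonomous {
  sa_smc :> sym_monoidal;
  star : sa_smc -> sa_smc;
  starm : forall a b : sa_smc, a ~> b -> star b ~> star a;
  star_id : forall a, starm (idm a) = idm (star a);
  star_comp : forall (a b c : sa_smc) (g : b ~> c) (f : a ~> b),
    starm (g \oc f) = starm f \oc starm g;
  star_ff : forall a b : sa_smc, bijective (@starm a b);
  curry : forall a b c : sa_smc, a \ox b ~> c -> a ~> star (b \ox star c);
  curry_bij : forall a b c : sa_smc, bijective (@curry a b c);
  curry_nat : forall (a a' b b' c c' : sa_smc)
      (k : a' ~> a) (l : b' ~> b) (h : c ~> c') (f : a \ox b ~> c),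
    curry (h \oc f \oc (k \oxm l))
    = starm (l \oxm starm h) \oc curry f \oc k }.

Record functor (C D : category) := Functor {
  fob :> C -> D;
  fmor : forall a b : C, a ~> b -> fob a ~> fob b;
  fmor_id : forall a, fmor (idm a) = idm (fob a);
  fmor_comp : forall (a b c : C) (g : b ~> c) (f : a ~> b),
    fmor (g \oc f) = fmor g \oc fmor f }.

Record strong_monoidal (C D : sym_monoidal) := StrongMonoidal {
  sm_fun :> functor C D;
  sm_unit : one ~> sm_fun one;
  sm_tens : forall a b : C, sm_fun a \ox sm_fun b ~> sm_fun (a \ox b);
  sm_unit_iso : is_iso sm_unit;
  sm_tens_iso : forall a b, is_iso (sm_tens a b);
  sm_tens_nat : forall (a a' b b' : C) (f : a ~> a') (g : b ~> b'),
    sm_tens a' b' \oc (fmor sm_fun f \oxm fmor sm_fun g)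
    = fmor sm_fun (f \oxm g) \oc sm_tens a b;
  sm_assoc : forall a b c : C,
    fmor sm_fun (assoc a b c) \oc sm_tens (a \ox b) c
      \oc (sm_tens a b \oxm idm (sm_fun c))
    = sm_tens a (b \ox c) \oc (idm (sm_fun a) \oxm sm_tens b c)
      \oc assoc (sm_fun a) (sm_fun b) (sm_fun c);
  sm_lunit : forall a : C,
    fmor sm_fun (lunit a) \oc sm_tens one a
      \oc (sm_unit \oxm idm (sm_fun a)) = lunit (sm_fun a);
  sm_runit : forall a : C,
    fmor sm_fun (runit a) \oc sm_tens a one
      \oc (idm (sm_fun a) \oxm sm_unit) = runit (sm_fun a) }.

(* [saf_curry]: modulo the structure isomorphisms
     F (star (b \ox star c)) ~ star (F b \ox F (star c)) ~ star (F b \ox star (F c)),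
   F (curry f) is curry of F f; the equation is written in
   F a ~> star (F b \ox F (star c)) so as to avoid inverses. *)
Record star_functor (C D : star_autonomous) := StarFunctor {
  saf_sm :> strong_monoidal C D;
  saf_star : forall c : C, saf_sm (star c) ~> star (saf_sm c);
  saf_star_iso : forall c, is_iso (saf_star c);
  saf_star_nat : forall (a b : C) (f : a ~> b),
    saf_star a \oc fmor saf_sm (starm f)
    = starm (fmor saf_sm f) \oc saf_star b;
  saf_curry : forall (a b c : C) (f : a \ox b ~> c),
    starm (sm_tens saf_sm b (star c)) \oc saf_star (b \ox star c)
      \oc fmor saf_sm (curry f)
    = starm (idm (saf_sm b) \oxm saf_star c)
      \oc curry (fmor saf_sm f \oc sm_tens saf_sm a b) }.

(* The tensor product of finite-dimensional spaces, in coordinates with respect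
   to the chosen bases [vbasis fullv]; [tliftE] and [tensor_ext] are its
   universal property. *)
Section Tensor.
Variable K : fieldType.
Implicit Types U V W : vectType K.

Definition tensor V W : vectType K := 'M[K]_(\dim {:V}, \dim {:W}).

Definition ptensor V W (v : V) (w : W) : tensor V W :=
  \matrix_(i, j) (coord (vbasis {:V}) i v * coord (vbasis {:W}) j w).

Definition tlift V W U (beta : V -> W -> U) : 'Hom(tensor V W, U) :=
  linfun (fun M : 'M[K]_(\dim {:V}, \dim {:W}) =>
    \sum_i \sum_j M i j *: beta (vbasis {:V})`_i (vbasis {:W})`_j).

Definition tmap V V' W W' (f : 'Hom(V, V')) (g : 'Hom(W, W')) :
    'Hom(tensor V W, tensor V' W') :=
  tlift (fun v w => ptensor (f v) (g w)).

Definition dual V : vectType K := 'Hom(V, K^o).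

Definition dualm V W (f : 'Hom(V, W)) : 'Hom(dual W, dual V) :=
  linfun (fun xi : 'Hom(W, K^o) => (xi \o f)%VF).

Definition tassoc U V W : 'Hom(tensor (tensor U V) W, tensor U (tensor V W)) :=
  tlift (fun t w => tlift (fun u v => ptensor u (ptensor v w)) t).

Definition tlunit V : 'Hom(tensor K^o V, V) := tlift (fun (a : K^o) v => a *: v).
Definition trunit V : 'Hom(tensor V K^o, V) := tlift (fun v (a : K^o) => a *: v).
Definition tbraid V W : 'Hom(tensor V W, tensor W V) :=
  tlift (fun v w => ptensor w v).

(* f is sent to v |-> (w \ox xi |-> xi (f (v \ox w))) *)
Definition tcurry V W U (f : 'Hom(tensor V W, U)) :
    'Hom(V, dual (tensor W (dual U))) :=
  linfun (fun v => tlift (fun w (xi : 'Hom(U, K^o)) => xi (f (ptensor v w)))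
                   : dual _).

Lemma linfE V W (f : V -> W) : linear f -> linfun f =1 f.
Proof.
move=> lf v; pose F := GRing.isLinear.Build _ _ _ _ f lf.
pose L : {linear V -> W} := HB.pack f F.
by rewrite -[f]/(L : V -> W) lfunE.
Qed.

Lemma sum_basis V (v : V) :
  v = \sum_i coord (vbasis {:V}) i v *: (vbasis {:V})`_i.
Proof. exact/coord_vbasis/memvf. Qed.

Lemma tlift_linear V W U (beta : V -> W -> U) :
  linear (fun M : 'M[K]_(\dim {:V}, \dim {:W}) =>
    \sum_i \sum_j M i j *: beta (vbasis {:V})`_i (vbasis {:W})`_j).
Proof.
move=> a M N; rewrite scaler_sumr -big_split; apply: eq_bigr => i _ /=.
rewrite scaler_sumr -big_split; apply: eq_bigr => j _ /=.
by rewrite !mxE scalerDl scalerA.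
Qed.

Local Notation bilin f := (bilinear_for *:%R *:%R f).

Lemma lin_sum V W (f : V -> W) I (r : seq I) (c : I -> K) (x : I -> V) :
  linear f -> f (\sum_(i <- r) c i *: x i) = \sum_(i <- r) c i *: f (x i).
Proof.
move=> lf; rewrite -(linfE lf) linear_sum; apply: eq_bigr => i _.
by rewrite linearZ /= linfE.
Qed.

Lemma tliftE V W U (beta : V -> W -> U) v w :
  bilin beta -> tlift beta (ptensor v w) = beta v w.
Proof.
move=> [bl br]; rewrite linfE; last exact: tlift_linear.
rewrite {2}(sum_basis v) (lin_sum _ _ _ (bl w)); apply: eq_bigr => i _.
rewrite {2}(sum_basis w) (lin_sum _ _ _ (br _)) scaler_sumr.
by apply: eq_bigr => j _; rewrite mxE scalerA.
Qed.

Lemma ptensor_bilin V W : bilin (@ptensor V W).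
Proof.
split=> u a x y; apply/matrixP=> i j; rewrite !mxE linearP /=.
  by rewrite mulrDl mulrA.
by rewrite mulrDr mulrCA.
Qed.

Lemma ptensorZ V W a (v : V) (w : W) : ptensor (a *: v) w = ptensor v (a *: w).
Proof.
by apply/matrixP=> i j; rewrite !mxE !linearZ /= mulrCA mulrA.
Qed.

Lemma tensor_ext V W U (f g : 'Hom(tensor V W, U)) :
  (forall v w, f (ptensor v w) = g (ptensor v w)) -> f = g.
Proof.
move=> fg; apply/lfunP => M.
have free V' : free (vbasis {:V'}) by apply: basis_free; exact: vbasisP.
suff -> : M = \sum_i \sum_j
    (M : 'M[K]_(_, _)) i j *: ptensor (vbasis {:V})`_i (vbasis {:W})`_j.
  rewrite !linear_sum; apply: eq_bigr => i _.
  by rewrite !linear_sum; apply: eq_bigr => j _; rewrite !linearZ /= fg.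
apply/matrixP => i j; rewrite summxE (bigD1 i) //= [X in _ + X]big1 ?addr0.
  rewrite summxE (bigD1 j) //= [X in _ + X]big1 ?addr0.
    by rewrite !mxE !coord_free ?free // !eqxx !mulr1.
  move=> k /negPf kj; rewrite !mxE !coord_free ?free //.
  by rewrite kj !mulr0.
move=> k /negPf ki; rewrite summxE big1 // => l _.
by rewrite !mxE !coord_free ?free // ki mul0r mulr0.
Qed.

Lemma tensor_ext3 T U V W (f g : 'Hom(tensor (tensor T U) V, W)) :
  (forall t u v, f (ptensor (ptensor t u) v) = g (ptensor (ptensor t u) v)) ->
  f = g.
Proof.
move=> fg; apply: tensor_ext => x v.
pose p := linfun (fun x => ptensor x v : tensor (tensor T U) V).
have pE : p =1 (ptensor (W := V))^~ v by apply: linfE; apply: (ptensor_bilin _ _).1.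
rewrite -pE -!comp_lfunE; congr (fun_of_lfun _ x).
by apply: tensor_ext => t u; rewrite !comp_lfunE pE.
Qed.

Lemma tensor_ext4 S T U V W (f g : 'Hom(tensor (tensor (tensor S T) U) V, W)) :
  (forall s t u v, f (ptensor (ptensor (ptensor s t) u) v)
     = g (ptensor (ptensor (ptensor s t) u) v)) -> f = g.
Proof.
move=> fg; apply: tensor_ext => x v.
pose p := linfun (fun x => ptensor x v : tensor (tensor (tensor S T) U) V).
have pE : p =1 (ptensor (W := V))^~ v by apply: linfE; apply: (ptensor_bilin _ _).1.
rewrite -pE -!comp_lfunE; congr (fun_of_lfun _ x).
by apply: tensor_ext3 => s t u; rewrite !comp_lfunE pE.
Qed.

Lemma tensor_ext3r T U V W (f g : 'Hom(tensor T (tensor U V), W)) :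
  (forall t u v, f (ptensor t (ptensor u v)) = g (ptensor t (ptensor u v))) ->
  f = g.
Proof.
move=> fg; apply: tensor_ext => t x.
pose p := linfun (fun x => ptensor t x : tensor T (tensor U V)).
have pE : p =1 ptensor t by apply: linfE; apply: (ptensor_bilin _ _).2.
rewrite -pE -!comp_lfunE; congr (fun_of_lfun _ x).
by apply: tensor_ext => u v; rewrite !comp_lfunE pE.
Qed.

Lemma tmapE V V' W W' (f : 'Hom(V, V')) (g : 'Hom(W, W')) v w :
  tmap f g (ptensor v w) = ptensor (f v) (g w).
Proof.
apply: tliftE; split=> u a x y; rewrite linearP.
  exact: (ptensor_bilin _ _).1.
exact: (ptensor_bilin _ _).2.
Qed.

Lemma tlift_add V W U (b b1 b2 : V -> W -> U) a :
  (forall v w, b v w = a *: b1 v w + b2 v w) ->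
  tlift b = a *: tlift b1 + tlift b2.
Proof.
move=> bE; apply/lfunP => M; rewrite add_lfunE scale_lfunE.
rewrite !linfE; try exact: tlift_linear.
rewrite scaler_sumr -big_split; apply: eq_bigr => i _ /=.
rewrite scaler_sumr -big_split; apply: eq_bigr => j _ /=.
by rewrite bE scalerDr !scalerA mulrC.
Qed.

Lemma tassocE U V W (u : U) (v : V) (w : W) :
  tassoc U V W (ptensor (ptensor u v) w) = ptensor u (ptensor v w).
Proof.
rewrite tliftE.
  rewrite tliftE //; split=> x a y z; first exact: (ptensor_bilin _ _).1.
  by rewrite (ptensor_bilin _ _).1 (ptensor_bilin _ _).2.
split=> x a y z; first exact: linearP.
rewrite (tlift_add (a := a) (b1 := fun u v => ptensor u (ptensor v y))
  (b2 := fun u v => ptensor u (ptensor v z))) ?lfun_simp //.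
by move=> u' v'; rewrite !(ptensor_bilin _ _).2.
Qed.

Definition tassoc_inv U V W : 'Hom(tensor U (tensor V W), tensor (tensor U V) W) :=
  tlift (fun u t => tlift (fun v w => ptensor (ptensor u v) w) t).

Lemma tassoc_invE U V W (u : U) (v : V) (w : W) :
  tassoc_inv U V W (ptensor u (ptensor v w)) = ptensor (ptensor u v) w.
Proof.
rewrite tliftE.
  rewrite tliftE //; split=> x a y z; last exact: (ptensor_bilin _ _).2.
  by rewrite (ptensor_bilin _ _).2 (ptensor_bilin _ _).1.
split=> x a y z; last exact: linearP.
rewrite (tlift_add (a := a) (b1 := fun v w => ptensor (ptensor y v) w)
  (b2 := fun v w => ptensor (ptensor z v) w)) ?lfun_simp //.
by move=> u' v'; rewrite !(ptensor_bilin _ _).1.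
Qed.

Lemma tlunitE V (a : K^o) (v : V) : tlunit V (ptensor a v) = a *: v.
Proof.
apply: tliftE; split=> x b y z; first by rewrite scalerDl -scalerA.
by rewrite scalerDr scalerA [x * b]mulrC -scalerA.
Qed.

Lemma trunitE V (a : K^o) (v : V) : trunit V (ptensor v a) = a *: v.
Proof.
apply: tliftE; split=> x b y z; last by rewrite scalerDl -scalerA.
by rewrite scalerDr scalerA [x * b]mulrC -scalerA.
Qed.

Lemma tbraidE V W (v : V) (w : W) : tbraid V W (ptensor v w) = ptensor w v.
Proof.
apply: tliftE; split=> x b y z; first exact: (ptensor_bilin _ _).2.
exact: (ptensor_bilin _ _).1.
Qed.

Lemma dualmE V W (f : 'Hom(V, W)) (xi : 'Hom(W, K^o)) (v : V) :
  (dualm f xi : 'Hom(V, K^o)) v = xi (f v).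
Proof.
rewrite linfE ?comp_lfunE // => a x y; apply/lfunP => u.
by rewrite !lfun_simp.
Qed.

Lemma tcurryE V W U (f : 'Hom(tensor V W, U)) v w (xi : 'Hom(U, K^o)) :
  (tcurry f v : 'Hom(tensor W (dual U), K^o)) (ptensor w (xi : dual U))
  = xi (f (ptensor v w)).
Proof.
rewrite linfE.
  apply: (tliftE (V := W) (W := dual U) (U := K^o)); split=> x a y z.
    by rewrite (ptensor_bilin _ _).2 !linearP.
  by rewrite !lfun_simp.
move=> a x y; apply: tlift_add => w' x'.
by rewrite (ptensor_bilin _ _).1 !linearP.
Qed.

Definition cform V i : 'Hom(V, K^o) := linfun (coord (vbasis {:V}) i : V -> K^o).

Lemma cformE V i v : @cform V i v = coord (vbasis {:V}) i v.
Proof. exact: lfunE. Qed.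

Lemma form_ext V (x y : V) : (forall xi : 'Hom(V, K^o), xi x = xi y) -> x = y.
Proof.
move=> xy; rewrite (sum_basis x) (sum_basis y); apply: eq_bigr => i _.
by rewrite -!cformE xy.
Qed.

Lemma form_sum V (xi : 'Hom(V, K^o)) : xi = \sum_(i < \dim {:V}) xi ((vbasis {:V})`_i) *: @cform V i.
Proof.
apply/lfunP => v; rewrite sum_lfunE {1}(sum_basis v) linear_sum.
by apply: eq_bigr => i _; rewrite linearZ scale_lfunE cformE; exact: mulrC.
Qed.

Lemma dualm_bij V W : bijective (@dualm V W).
Proof.
pose inv (g : 'Hom(dual W, dual V)) : 'Hom(V, W) :=
  linfun (fun v => \sum_(i < \dim {:W}) (g (@cform W i) : 'Hom(V, K^o)) v *: (vbasis {:W})`_i).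
have invE g v : inv g v =
    \sum_(i < \dim {:W}) (g (@cform W i) : 'Hom(V, K^o)) v *: (vbasis {:W})`_i.
  apply: linfE => a x y; rewrite scaler_sumr -big_split; apply: eq_bigr => i _ /=.
  by rewrite linearP scalerDl scalerA.
exists inv => [f|g]; apply/lfunP => x.
  rewrite invE [RHS]sum_basis; apply: eq_bigr => i _.
  by rewrite dualmE cformE.
apply/(lfunP (_ : 'Hom(V, K^o))) => v.
rewrite dualmE invE linear_sum [in RHS](form_sum x) linear_sum sum_lfunE.
by apply: eq_bigr => i _; rewrite !linearZ scale_lfunE; exact: mulrC.
Qed.

Lemma tcurry_bij V W U : bijective (@tcurry V W U).
Proof.
pose G (h : 'Hom(V, dual (tensor W (dual U)))) v w i : K :=
  (h v : 'Hom(tensor W (dual U), K^o)) (ptensor w (@cform U i : dual U)).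
pose inv (h : 'Hom(V, dual (tensor W (dual U)))) : 'Hom(tensor V W, U) :=
  tlift (fun v w => \sum_(i < \dim {:U}) G h v w i *: (vbasis {:U})`_i).
have invE h v w : inv h (ptensor v w) = \sum_(i < \dim {:U}) G h v w i *: (vbasis {:U})`_i.
  rewrite tliftE //; split=> x a y z /=; rewrite scaler_sumr -big_split;
    apply: eq_bigr => i _ /=; rewrite /G.
    by rewrite linearP add_lfunE scale_lfunE scalerDl scalerA.
  by rewrite (ptensor_bilin _ _).1 linearP scalerDl scalerA.
exists inv => [f|h].
  apply: tensor_ext => v w; rewrite invE [RHS]sum_basis; apply: eq_bigr => i _.
  by rewrite /G tcurryE cformE.
apply/lfunP => v; apply: tensor_ext => w x.
rewrite tcurryE invE linear_sum [in RHS](form_sum x).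
pose q := linfun (fun x : dual U => ptensor w x).
have qE : q =1 ptensor w by apply: linfE; apply: (ptensor_bilin _ _).2.
rewrite -qE !linear_sum; apply: eq_bigr => i _.
by rewrite !linearZ /G -qE; exact: mulrC.
Qed.

End Tensor.

Section FVec.
Variable K : fieldType.

Definition FVec_cat : category := @Category (vectType K)
  (fun V W => 'Hom(V, W)) (fun V => \1%VF) (fun U V W g f => (g \o f)%VF)
  (fun _ _ _ _ h g f => comp_lfunA h g f)
  (fun _ _ f => comp_lfun1l f) (fun _ _ f => comp_lfun1r f).

Definition FVec_smc : sym_monoidal.
Proof.
refine (@SymMonoidal FVec_cat (@tensor K)
  (fun V V' W W' f g => @tmap K V V' W W' f g) _ _
  (K^o : vectType K) (@tassoc K) (@tlunit K) (@trunit K) (@tbraid K)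
  _ _ _ _ _ _ _ _ _ _ _) => /=.
- move=> V W; apply: tensor_ext => v w.
  by rewrite tmapE !id_lfunE.
- move=> U U' U'' V V' V'' f' f g' g; apply: tensor_ext => u v.
  by rewrite !(comp_lfunE, tmapE).
- move=> U V W; exists (tassoc_inv U V W); split => /=.
    by apply: tensor_ext3 => u v w; rewrite comp_lfunE tassocE tassoc_invE id_lfunE.
  by apply: tensor_ext3r => u v w; rewrite comp_lfunE tassoc_invE tassocE id_lfunE.
- move=> V; pose q : 'Hom(V, tensor K^o V) := linfun (@ptensor K K^o V 1).
  have qE : q =1 @ptensor K K^o V 1 by apply: linfE; apply: (ptensor_bilin _ _).2.
  exists q; split => /=; last first.
    by apply/lfunP => v; rewrite comp_lfunE qE tlunitE scale1r id_lfunE.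
  apply: tensor_ext => a v; rewrite comp_lfunE tlunitE qE id_lfunE -ptensorZ.
  by congr ptensor; exact: mulr1.
- move=> V; pose q : 'Hom(V, tensor V K^o) :=
    linfun (fun v => @ptensor K V K^o v 1).
  have qE : q =1 (@ptensor K V K^o)^~ 1.
    by apply: linfE; apply: (ptensor_bilin _ _).1.
  exists q; split => /=; last first.
    by apply/lfunP => v; rewrite comp_lfunE qE trunitE scale1r id_lfunE.
  apply: tensor_ext => v a; rewrite comp_lfunE trunitE qE id_lfunE ptensorZ.
  by congr ptensor; exact: mulr1.
- move=> U U' V V' W W' f g h; apply: tensor_ext3 => u v w.
  by rewrite !(comp_lfunE, tmapE, tassocE).
- move=> V V' f; apply: tensor_ext => a v.
  by rewrite !(comp_lfunE, tmapE, tlunitE) id_lfunE linearZ.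
- move=> V V' f; apply: tensor_ext => v a.
  by rewrite !(comp_lfunE, tmapE, trunitE) id_lfunE linearZ.
- move=> V V' W W' f g; apply: tensor_ext => v w.
  by rewrite !(comp_lfunE, tmapE, tbraidE).
- move=> U V W Z; apply: tensor_ext4 => u v w z.
  by rewrite !(comp_lfunE, tmapE, tassocE, id_lfunE).
- move=> V W; apply: tensor_ext3 => v a w.
  by rewrite !(comp_lfunE, tmapE, tassocE, tlunitE, trunitE, id_lfunE) ptensorZ.
- move=> U V W; apply: tensor_ext3 => u v w.
  by rewrite !(comp_lfunE, tmapE, tassocE, tbraidE, id_lfunE).
- move=> V W; apply: tensor_ext => v w.
  by rewrite !(comp_lfunE, tbraidE, id_lfunE).
Defined.

Definition FVec : star_autonomous.
Proof.
refine (@StarAutonomous FVec_smc (@dual K) (@dualm K) _ _ (@dualm_bij K)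
  (@tcurry K) (@tcurry_bij K) _) => /=.
- move=> V; apply/lfunP => x; apply/lfunP => v.
  by rewrite dualmE !id_lfunE.
- move=> U V W g f; apply/lfunP => x; apply/lfunP => u.
  by rewrite !(dualmE, comp_lfunE).
- move=> V V' W W' U U' k l h f; apply/lfunP => v; apply: tensor_ext => w x.
  by rewrite !(tcurryE, comp_lfunE, dualmE, tmapE).
Defined.

End FVec.

Definition stem (R : realType) (C : star_autonomous) := star_functor C (FVec R).

Section Stem.
Variables (R : realType) (C : star_autonomous) (S : stem R C).

Definition sob (c : C) : vectType R := S c.

Definition smor (c d : C) (phi : c ~> d) : 'Hom(sob c, sob d) := fmor S phi.

(* S (star one) ~ dual (S one) ~ dual R^o ~ R, the last map being xi |-> xi 1 *)
Definition star_one_val (y : sob (star one)) : R :=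
  (saf_star S one y : 'Hom(sob one, R^o)) (sm_unit S (1 : R^o)).

Definition stens (c d : C) : 'Hom(tensor (sob c) (sob d), sob (c \ox d)) :=
  sm_tens S c d.

Definition Acone (c : C) : set (sob c) :=
  [set v | forall phi : c ~> star one, 0 <= star_one_val (smor phi v)].
Arguments Acone c : clear implicits.

(* A cone contains 0; the topology on matrices is the usual Euclidean one. *)
Definition closed_convex_cone m n (A : set 'M[R]_(m, n)) :=
  [/\ closed A, A 0, (forall x y, A x -> A y -> A (x + y)) &
      forall (t : R) x, 0 <= t -> A x -> A (t *: x)].

Record system (X : vectType R) := System {
  level :> forall c : C, set (tensor X (sob c));
  level_ccc : forall c, closed_convex_cone (@level c);
  level_mor : forall (c d : C) (Phi : c ~> d),
    tmap \1%VF (smor Phi) @` @level c `<=` @level d }.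
Arguments level {X} _ c.

Definition intrinsic (d c : C) : set (tensor (sob d) (sob c)) :=
  stens d c @^-1` Acone (d \ox c).
Arguments intrinsic d c : clear implicits.

(* Level-wise intersection. [\bigcap] is not available for this index type: by
   universe constraints, [set T] does not accept T := system X. *)
Definition inter_level (X : vectType R) (Hs : system X -> Prop) (c : C) :
    set (tensor X (sob c)) :=
  [set x | forall H : system X, Hs H -> level H c x].

Definition concretely_realizable (X : vectType R) (G : system X) :=
  exists (d : C) (Psi : 'Hom(X, sob d)),
    forall c, G c = tmap Psi \1%VF @^-1` intrinsic d c.

(* For n = 0 this is the full system, which is also realized by Psi = 0. *)
Definition hedron (X : vectType R) (G : system X) :=
  exists (n : nat) (H : 'I_n -> system X),
    (forall i, concretely_realizable (H i)) /\
    forall c, G c = \bigcap_(i in [set: 'I_n]) H i c.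

End Stem.

Arguments Acone {R C} S c.
Arguments intrinsic {R C} S d c.
Arguments level {R C S X} _ c.
Arguments inter_level {R C S X} Hs c.

(* Main.v *)
Require Import Defs.
From mathcomp Require Import all_boot all_order all_algebra.
From mathcomp Require Import all_classical all_reals all_analysis.
From mathcomp Require Import ring lra.

(** Closed convex cones in finite dimension are intersections of half-spaces,
    and each half-space that contains a level of a system [G] gives a hedron
    that contains [G].

    Let [x] lie outside [G d].  A linear form [f] on [X (x) S d] is nonnegative
    on [G d] and negative at [x] ([cone_separation]: take the point of the cone
    nearest to [x]).  Let [H c] consist of the [y] such that
    [f ((id (x) S Phi) y) >= 0] for every [Phi : c ~> d].  This is a system
    ([cogen_system]); it contains [G] because [G] is stable under morphisms,
    and the choice [Phi = id] shows that it misses [x].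

    The system [H] has a concrete realization over [star d]
    ([cogen_realizable]).  The form [f] is the same thing as a linear map from
    [X] to the dual of [S d], which is [S (star d)].  What has to be seen is
    that the forms [S phi], for [phi : star d \ox c ~> star one], are exactly
    the forms [xi (x) v |-> xi (S Phi v)], for [Phi : c ~> d] ([form_to_mor]
    and [mor_to_form]).  Categorically, [phi] corresponds under [curry] to a
    morphism [star d ~> star (c \ox star (star one))], that is to a morphism
    [star d ~> star c] because [one] is isomorphic to its bidual, and the
    latter is dual to a unique [Phi] because the duality is full and faithful.
    A stem preserves [curry], duals and units, so the correspondence takes the
    stated form on vectors.  With [star d] as the left factor this goes through
    without exchanging the factors, an operation that a strong monoidal functor
    may fail to preserve. *)

Set Implicit Arguments.
Unset Strict Implicit.
Unset Printing Implicit Defensive.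

Import Order.TTheory GRing.Theory Num.Theory numFieldNormedType.Exports.
Local Open Scope classical_set_scope.
Local Open Scope ring_scope.

(** * Separation of a point from a closed convex cone *)

Section Separation.
Variable R : realType.
Variables m n : nat.
Implicit Types x y z : 'M[R]_(m, n).

(** Carries the compactness of boxes over from row vectors to matrices. *)
Lemma vec_mx_continuous : continuous (@vec_mx R m n).
Proof.
move=> v A /nbhs_ballP[e e0 eA]; apply/nbhs_ballP; exists e => // w [_ vw].
by apply: eA; split=> // i j; rewrite !mxE; exact: vw.
Qed.

Lemma mx_box_compact (r : R) :
  compact [set y : 'M[R]_(m, n) | forall i j, `|y i j| <= r].
Proof.
have cA : compact [set v : 'rV[R]_(m * n) | forall k, `[- r, r]%classic (v ord0 k)].
  by apply: (@rV_compact _ _ (fun=> `[- r, r]%classic)) => _; apply: segment_compact.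
suff -> : [set y : 'M[R]_(m, n) | forall i j, `|y i j| <= r] =
    vec_mx @` [set v : 'rV[R]_(m * n) | forall k, `[- r, r]%classic (v ord0 k)].
  by apply: continuous_compact cA; apply: continuous_subspaceT; exact: vec_mx_continuous.
apply/seteqP; split=> [M MA|_ [v vA <-] i j].
  exists (mxvec M); last exact: mxvecK.
  by move=> k; case/mxvec_indexP: k => i j; rewrite /= mxvecE in_itv /= -ler_norml.
by rewrite mxE ler_norml; have := vA (mxvec_index i j); rewrite /= in_itv.
Qed.

Definition dot x y : R := \sum_i \sum_j x i j * y i j.

Lemma dotC x y : dot x y = dot y x.
Proof. by apply: eq_bigr => i _; apply: eq_bigr => j _; exact: mulrC. Qed.

Lemma dot_linear x : linear (dot x : _ -> R^o).
Proof.
move=> a y z; rewrite /dot scaler_sumr -big_split; apply: eq_bigr => i _ /=.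
rewrite scaler_sumr -big_split; apply: eq_bigr => j _ /=.
by rewrite !mxE mulrDr mulrCA.
Qed.

Lemma dotD x y z : dot x (y + z) = dot x y + dot x z.
Proof. by have := dot_linear x 1 y z; rewrite !scale1r. Qed.

Lemma dot0 x : dot x 0 = 0.
Proof. by have := dotD x 0 0; rewrite addr0; lra. Qed.

Lemma dotZ x a y : dot x (a *: y) = a * dot x y.
Proof. by have := dot_linear x a y 0; rewrite addr0 dot0 addr0. Qed.

Lemma dotN x y : dot x (- y) = - dot x y.
Proof. by rewrite -scaleN1r dotZ mulN1r. Qed.

Lemma dotDl x y z : dot (x + y) z = dot x z + dot y z.
Proof. by rewrite dotC dotD !(dotC z). Qed.

Lemma dotZl a x y : dot (a *: x) y = a * dot x y.
Proof. by rewrite dotC dotZ dotC. Qed.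

Lemma dot_ge0 x : 0 <= dot x x.
Proof. by apply: sumr_ge0 => i _; apply: sumr_ge0 => j _; rewrite -expr2 sqr_ge0. Qed.

Lemma dot_sqr_ge x i j : x i j ^+ 2 <= dot x x.
Proof.
rewrite /dot (bigD1 i) //= (bigD1 j) //= -expr2 -addrA lerDl addr_ge0 //.
  by apply: sumr_ge0 => k _; rewrite -expr2 sqr_ge0.
by apply: sumr_ge0 => k _; apply: sumr_ge0 => l _; rewrite -expr2 sqr_ge0.
Qed.

Lemma dot_gt0 x : x != 0 -> 0 < dot x x.
Proof.
move=> x0; rewrite ltNge; apply: contra x0 => d0; apply/eqP/matrixP => i j.
by apply/eqP; rewrite mxE -sqrf_eq0 eq_le sqr_ge0 (le_trans (dot_sqr_ge x i j)).
Qed.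

Lemma dot_continuous (T : topologicalType) (f g : T -> 'M[R]_(m, n)) :
  continuous f -> continuous g -> continuous (fun t => dot (f t) (g t)).
Proof.
move=> cf cg; apply: continuous_big => [|i _]; first exact: add_continuous.
apply: continuous_big => [|j _ t]; first exact: add_continuous.
apply: (@continuousM _ _ (fun t => f t i j) (fun t => g t i j)).
  apply: (@continuous_comp _ _ _ f (fun y => y i j)); first exact: cf.
  exact: coord_continuous.
apply: (@continuous_comp _ _ _ g (fun y => y i j)); first exact: cg.
exact: coord_continuous.
Qed.

(** The squared distance to [x] is continuous, and only the points of [A] that
    are at least as close to [x] as a given point of [A] compete for the
    minimum: these lie in a compact box around [x]. *)
Lemma closed_nearest (A : set 'M[R]_(m, n)) x :
  closed A -> A !=set0 ->
  exists2 p, A p & forall y, A y -> dot (p - x) (p - x) <= dot (y - x) (y - x).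
Proof.
move=> clA [a Aa]; pose q y := dot (y - x) (y - x); pose r := 1 + q a.
have cq : continuous q.
  by apply: dot_continuous => y; apply: (@continuousB _ _ _ id (cst x)) => //; exact: cst_continuous.
(* With [r = 1 + q a], [r ^ 2] is at least [q a], so the entries of [y - x]
   are bounded by [r] as soon as [q y <= q a]. *)
pose B := [set y : 'M[R]_(m, n) | forall i j, `|y i j| <= r].
pose K := ((fun y => y + x) @` B) `&` A.
have qa0 : 0 <= q a by exact: dot_ge0.
have inK y : A y -> q y <= q a -> K y.
  move=> Ay qy; split=> //; exists (y - x); last by rewrite subrK.
  move=> i j; rewrite -(@ler_pXn2r _ 2) ?nnegrE ?normr_ge0 ?addr_ge0 //.
  rewrite real_normK ?num_real //; apply: le_trans (dot_sqr_ge _ _ _) _.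
  by apply: (le_trans qy); rewrite /r; nra.
have cK : compact K.
  apply: compact_closedI => //; apply: continuous_compact; last exact: mx_box_compact.
  apply: continuous_subspaceT => y.
  by apply: (@continuousD _ _ _ id (cst x)) => //; exact: cst_continuous.
have [|p /set_mem[_ Ap] pmin] := compact_EVT_min _ cK (continuous_subspaceT cq).
  by exists a; exact: inK.
exists p => // y Ay; have [qy|/ltW qy] := leP (q y) (q a).
  by apply: pmin; apply/mem_set; exact: inK.
by apply: le_trans qy; apply: pmin; apply/mem_set; exact: inK.
Qed.

Lemma dot_sqrD x t y :
  dot (x + t *: y) (x + t *: y) = dot x x + t * (2 * dot x y + t * dot y y).
Proof. by rewrite dotD !dotDl !(dotZ, dotZl) (dotC y x); ring. Qed.

(** First-order optimality.  If the inner product [s] were negative, a short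
    step from [p] towards [y] would come closer to [x]. *)
Lemma nearest_obtuse (A : set 'M[R]_(m, n)) x p y :
  (forall t, 0 <= t <= 1 -> A (p + t *: (y - p))) ->
  (forall z, A z -> dot (p - x) (p - x) <= dot (z - x) (z - x)) ->
  0 <= dot (p - x) (y - p).
Proof.
move=> seg pmin; rewrite leNgt; apply/negP.
set u := p - x in pmin *; set z := y - p in seg *.
set s := dot u z => s0; set D := dot z z.
have D0 : 0 <= D by exact: dot_ge0.
(* The derivative of the squared distance is [2 s] at [t = 0] and increases
   at rate [2 D]; this [t] is in [0, 1] and small enough for the first-order
   term to win, even when [D = 0]. *)
pose t := - s / (1 + D - s).
have den0 : 0 < 1 + D - s by lra.
have tE : t * (1 + D - s) = - s by rewrite /t divfK // gt_eqF.
have t0 : 0 < t by rewrite /t divr_gt0 // oppr_gt0.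
have t1 : t <= 1 by nra.
have := pmin _ (seg t _); rewrite (ltW t0) t1 => /(_ isT).
have -> : p + t *: z - x = u + t *: z by rewrite addrAC.
rewrite dot_sqrD -/s -/D.
suff : t * (2 * s + t * D) < 0 by lra.
by rewrite pmulr_rlt0 //; nra.
Qed.

(** For the nearest point [p], the form [dot (p - x)] is nonnegative on the cone
    (move from [p] to [p + y]) and nonpositive at [p] (move from [p] to [0]);
    its value at [x] is that at [p] minus the positive number
    [dot (p - x) (p - x)]. *)
Lemma cone_separation (A : set 'M[R]_(m, n)) x :
  closed A -> A 0 -> (forall y z, A y -> A z -> A (y + z)) ->
  (forall t y, 0 <= t -> A y -> A (t *: y)) -> ~ A x ->
  exists2 u, (forall y, A y -> 0 <= dot u y) & dot u x < 0.
Proof.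
move=> clA A0 AD AZ Ax; have [|p Ap pmin] := closed_nearest x clA; first by exists 0.
have obtuse y : A y -> 0 <= dot (p - x) (y - p).
  move=> Ay; apply: nearest_obtuse pmin => t /andP[t0 t1].
  have -> : p + t *: (y - p) = (1 - t) *: p + t *: y.
    by rewrite scalerBl scale1r scalerBr addrA addrAC.
  by apply: AD; apply: AZ; rewrite ?subr_ge0.
exists (p - x) => [y Ay|].
  by have := obtuse _ (AD _ _ Ay Ap); rewrite addrK.
have := obtuse _ A0; rewrite sub0r dotN.
have : 0 < dot (p - x) (p - x).
  by apply: dot_gt0; rewrite subr_eq0; apply/eqP => px; apply: Ax; rewrite -px.
by rewrite dotD dotN; lra.
Qed.

Lemma linear_form_closed (g : 'Hom('M[R]_(m, n), R^o)) :
  closed [set x | 0 <= g x].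
Proof.
pose u : 'M[R]_(m, n) := \matrix_(i, j) g (delta_mx i j).
have gE x : g x = dot u x.
  rewrite {1}(matrix_sum_delta x) linear_sum; apply: eq_bigr => i _.
  by rewrite linear_sum; apply: eq_bigr => j _; rewrite linearZ mxE; exact: mulrC.
have -> : [set x | 0 <= g x] = dot u @^-1` [set y | 0 <= y].
  by apply/seteqP; split => x /=; rewrite gE.
apply: preimage_closed; last exact: closed_ge.
move=> x _; apply: (@dot_continuous _ (cst u) id).
  exact: cst_continuous.
by move=> y.
Qed.

End Separation.

Local Open Scope cat_scope.

(** * The action of a stem on vectors *)

Section Pairing.
Variables (R : realType) (C : star_autonomous) (S : stem R C).

(** The identification of [S (star c)] with the dual of [S c], read as a pairing. *)
Definition pairing (c : C) (xi : sob S (star c)) (v : sob S c) : R :=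
  (saf_star S c xi : 'Hom(sob S c, R^o)) v.

Definition unitv : sob S Defs.one := sm_unit S (1 : R^o).

Lemma smor_id (c : C) v : smor S (idm c) v = v.
Proof. by rewrite /smor fmor_id; exact: id_lfunE. Qed.

Lemma smor_comp (a b c : C) (g : b ~> c) (f : a ~> b) v :
  smor S (g \oc f) v = smor S g (smor S f v).
Proof. by rewrite /smor fmor_comp; exact: comp_lfunE. Qed.

Lemma smor_inv (a b : C) (f : a ~> b) (g : b ~> a) v w :
  g \oc f = idm a -> smor S f v = w -> smor S g w = v.
Proof. by move=> gf <-; rewrite -smor_comp gf smor_id. Qed.

(** The vector [v (x) w], under the identification of [S a (x) S b] with
    [S (a \ox b)]. *)
Definition spure (a b : C) (v : sob S a) (w : sob S b) : sob S (a \ox b) :=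
  stens S a b (ptensor v w).

Lemma smor_tensm (a a' b b' : C) (f : a ~> a') (g : b ~> b') v w :
  smor S (f \oxm g) (spure v w) = spure (smor S f v) (smor S g w).
Proof.
have := congr1 (fun h : 'Hom(tensor (sob S a) (sob S b), sob S (a' \ox b')) =>
   h (ptensor v w)) (sm_tens_nat S f g).
rewrite /spure /= !comp_lfunE => <-; congr (stens _ _ _ _).
by rewrite tmapE.
Qed.

Lemma smor_lunit (a : C) v : smor S (lunit a) (spure unitv v) = v.
Proof.
have := congr1 (fun h : 'Hom(tensor R^o (sob S a), sob S a) =>
   h (ptensor (1 : R^o) v)) (sm_lunit S a).
by rewrite /= !comp_lfunE tmapE tlunitE scale1r id_lfunE.
Qed.

Lemma smor_runit (a : C) v : smor S (runit a) (spure v unitv) = v.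
Proof.
have := congr1 (fun h : 'Hom(tensor (sob S a) R^o, sob S a) =>
   h (ptensor v (1 : R^o))) (sm_runit S a).
by rewrite /= !comp_lfunE tmapE trunitE scale1r id_lfunE.
Qed.

Lemma pairing_starm (a b : C) (f : a ~> b) xi v :
  pairing (smor S (starm f) xi) v = pairing xi (smor S f v).
Proof.
have := congr1 (fun h : 'Hom(sob S (star b), dual (sob S a)) =>
   (h xi : 'Hom(sob S a, R^o)) v) (saf_star_nat S f).
by rewrite /= !comp_lfunE dualmE.
Qed.

(** The compatibility of a stem with currying, on vectors: under the pairings,
    [S (curry f)] is the uncurried form [xi (S f (v (x) w))]. *)
Lemma pairing_curry (a b c : C) (f : a \ox b ~> c) v w xi :
  pairing (smor S (curry f) v) (spure w xi) = pairing xi (smor S f (spure v w)).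
Proof.
have := congr1 (fun h : 'Hom(sob S a, dual (tensor (sob S b) (sob S (star c)))) =>
   (h v : 'Hom(tensor (sob S b) (sob S (star c)), R^o)) (ptensor w xi)) (saf_curry S f).
by rewrite /= !comp_lfunE !dualmE tmapE id_lfunE tcurryE comp_lfunE.
Qed.

Lemma pairing_inj (c : C) v v' :
  (forall xi : sob S (star c), pairing xi v = pairing xi v') -> v = v'.
Proof.
move=> vv'; apply: form_ext => xi; have [g [_ fg]] := saf_star_iso S c.
by have := congr1 (fun h : 'Hom(dual (sob S c), dual (sob S c)) => h xi) fg;
   rewrite /= comp_lfunE id_lfunE => <-; exact: vv'.
Qed.

End Pairing.

(** * Forms on a tensor product and morphisms *)

Section Evaluation.
Variables (R : realType) (C : star_autonomous) (S : stem R C).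

(** The comparison of the unit with its bidual is the transpose, under [curry],
    of the identity of the unit; on vectors, its value at the unit vector is
    evaluation at the unit vector. *)
Lemma unit_bidual : exists u : Defs.one ~> star (star (Defs.one : C)),
  forall y : sob S (star Defs.one),
    pairing (smor S u (unitv S)) y = star_one_val y.
Proof.
have [linv [lK _]] := lunit_iso (star (Defs.one : C)).
exists (starm linv \oc curry (lunit Defs.one)) => y.
rewrite smor_comp pairing_starm (smor_inv lK (smor_lunit y)).
by rewrite pairing_curry smor_lunit.
Qed.

(** The inverse comparison, applied to the vector that [unit_bidual] produces.
    The pairing determines the result, because the forms [pairing y] separate
    points. *)
Lemma bidual_unit (z : sob S (star (star Defs.one))) :
  (forall y : sob S (star Defs.one), pairing z y = star_one_val y) ->
  exists w : star (star (Defs.one : C)) ~> Defs.one, smor S w z = unitv S.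
Proof.
move=> zE; have [rinv [rK _]] := runit_iso (star (star (Defs.one : C))).
have [unc _ uncK] := curry_bij (star (star (Defs.one : C))) Defs.one Defs.one.
exists (unc (starm (lunit (star Defs.one))) \oc rinv).
rewrite smor_comp (smor_inv rK (smor_runit z)); apply: pairing_inj => y.
by rewrite -pairing_curry uncK pairing_starm smor_lunit zE.
Qed.

(** Curry [phi], replace the bidual of the unit by the unit, and use that the duality is full
    to write the resulting morphism [star d ~> star c] as the dual of some
    [Phi]. *)
Lemma form_to_mor (c d : C) (phi : star d \ox c ~> star Defs.one) :
  exists Phi : c ~> d, forall xi v,
    star_one_val (smor S phi (spure xi v)) = pairing xi (smor S Phi v).
Proof.
have [u uE] := unit_bidual; have [rinv [rK _]] := runit_iso c.
have [unstar _ unstarK] := star_ff c d.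
exists (unstar (starm ((idm c \oxm u) \oc rinv) \oc curry phi)) => xi v.
rewrite -pairing_starm unstarK smor_comp pairing_starm smor_comp.
rewrite (smor_inv rK (smor_runit v)) smor_tensm smor_id pairing_curry.
exact/esym/uE.
Qed.

(** The inverse construction: uncurry the dual of [Phi], with the bidual of the
    unit put back in. *)
Lemma mor_to_form (c d : C) (Phi : c ~> d) :
  exists phi : star d \ox c ~> star Defs.one, forall xi v,
    star_one_val (smor S phi (spure xi v)) = pairing xi (smor S Phi v).
Proof.
have [u uE] := unit_bidual; have [w wE] := bidual_unit uE.
have [unc _ uncK] := curry_bij (star d) c (star Defs.one).
exists (unc (starm (Phi \oc runit c \oc (idm c \oxm w)))) => xi v.
rewrite -uE -pairing_curry uncK pairing_starm 2!smor_comp smor_tensm wE.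
by rewrite smor_id smor_runit.
Qed.

End Evaluation.

(** * The system cut out by a linear form *)

Section Cogenerated.
Variables (R : realType) (C : star_autonomous) (S : stem R C).
Variables (X : vectType R) (d : C) (f : 'Hom(tensor X (sob S d), R^o)).

(** The largest system whose level at [d] lies in the half-space [0 <= f]. *)
Definition cogen_level (c : C) : set (tensor X (sob S c)) :=
  [set x | forall Phi : c ~> d, 0 <= f (tmap \1%VF (smor S Phi) x)].
Arguments cogen_level : clear implicits.

Lemma tmap_comp_mor (a b c : C) (g : b ~> c) (h : a ~> b) (x : tensor X (sob S a)) :
  tmap (\1%VF : 'Hom(X, X)) (smor S (g \oc h)) x =
  tmap \1%VF (smor S g) (tmap \1%VF (smor S h) x).
Proof.
rewrite -comp_lfunE; congr (fun_of_lfun _ x); apply: tensor_ext => v w.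
by rewrite comp_lfunE !tmapE !id_lfunE smor_comp.
Qed.

Lemma cogen_ccc c : closed_convex_cone (cogen_level c).
Proof.
split=> [| Phi | x y xp yp Phi | t x t0 xp Phi].
- have -> : cogen_level c =
      \bigcap_(Phi in [set: c ~> d])
        [set x | 0 <= (f \o tmap \1%VF (smor S Phi))%VF x].
    apply/seteqP; split=> [x xp Phi _|x xp Phi].
      by rewrite /= comp_lfunE; exact: xp.
    by have := xp Phi I; rewrite /= comp_lfunE.
  by apply: closed_bigI => Phi _; apply: linear_form_closed.
- by rewrite !linear0.
- by rewrite !linearD addr_ge0 //; [exact: xp|exact: yp].
- by rewrite !linearZ mulr_ge0 //; exact: xp.
Qed.

Lemma cogen_mor (c c' : C) (Psi : c ~> c') :
  tmap \1%VF (smor S Psi) @` cogen_level c `<=` cogen_level c'.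
Proof. by move=> _ [x xp <-] Phi; rewrite -tmap_comp_mor; exact: xp. Qed.

Definition cogen_system : system S X := System cogen_ccc cogen_mor.

Definition form_curry : 'Hom(X, dual (sob S d)) :=
  linfun (fun x => linfun (fun v => f (ptensor x v)) : dual (sob S d)).

Lemma form_curryE x v : (form_curry x : 'Hom(sob S d, R^o)) v = f (ptensor x v).
Proof.
have ptl := ptensor_bilin X (sob S d).
have inE y w : (linfun (fun v => f (ptensor y v)) : 'Hom(sob S d, R^o)) w = f (ptensor y w).
  by apply: linfE => a w1 w2; rewrite ptl.2 linearP.
rewrite linfE ?inE // => a y1 y2; apply/lfunP => w.
by rewrite add_lfunE scale_lfunE !inE ptl.1 linearP.
Qed.

Lemma form_realized : exists Psi : 'Hom(X, sob S (star d)),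
  forall x v, pairing (Psi x) v = f (ptensor x v).
Proof.
have [g [_ sgK]] := saf_star_iso S d.
exists (g \o form_curry)%VF => x v; rewrite -form_curryE comp_lfunE /pairing.
by have := congr1 (fun h : 'Hom(dual (sob S d), dual (sob S d)) => h (form_curry x)) sgK;
   rewrite /= comp_lfunE id_lfunE => ->.
Qed.

(** With [Psi] representing [f], the inequalities that define the intrinsic
    system over [star d], pulled back along [Psi], are indexed by the morphisms
    [phi : star d \ox c ~> star one].  By [form_to_mor] and [mor_to_form] they are the
    same inequalities as those indexed by [Phi : c ~> d]. *)
Lemma cogen_realizable : concretely_realizable cogen_system.
Proof.
have [Psi PsiE] := form_realized.
exists (star d), Psi => c.
have transport (phi : star d \ox c ~> star Defs.one) (Phi : c ~> d) :
    (forall xi v,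
      star_one_val (smor S phi (spure xi v)) = pairing xi (smor S Phi v)) ->
    forall x, star_one_val (smor S phi (stens S (star d) c (tmap Psi \1%VF x))) =
      f (tmap \1%VF (smor S Phi) x).
  move=> E x.
  pose ev : 'Hom(sob S (star Defs.one), R^o) :=
    linfun (fun y => star_one_val y : R^o).
  have evE y : ev y = star_one_val y.
    apply: linfE => a y1 y2; rewrite /star_one_val linearP.
    by rewrite add_lfunE scale_lfunE.
  rewrite -evE -!comp_lfunE; congr (fun_of_lfun _ x); apply: tensor_ext => y v.
  by rewrite !comp_lfunE !tmapE !id_lfunE evE E PsiE.
apply/seteqP; split=> x xp => [phi|Phi].
  by have [Phi /transport->] := form_to_mor S phi; exact: xp.
by have [phi /transport<-] := mor_to_form S Phi; exact: xp.
Qed.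

End Cogenerated.

Lemma realizable_hedron (R : realType) (C : star_autonomous) (S : stem R C)
    (X : vectType R) (G : system S X) : concretely_realizable G -> hedron G.
Proof.
move=> Gr; exists 1%N, (fun=> G); split=> // c.
by apply/seteqP; split=> [x Gx i _ //|x /(_ ord0 I)].
Qed.

(** * Systems as intersections of hedra *)

Theorem theorem3p22 (R : realType) (C : star_autonomous) (S : stem R C)
    (X : vectType R) (G : system S X) :
  exists Hs : system S X -> Prop,
    (forall H : system S X, Hs H -> hedron H) /\
    (forall c : C, level G c = inter_level Hs c).
Proof.
exists (fun H => hedron H /\ forall c, G c `<=` H c); split=> [H []//|d].
apply/seteqP; split=> [x Gx H [_ GH]|x Hx]; first exact: GH.
apply: contrapT => Gx; have [clG G0 GD GZ] := level_ccc G d.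
have [u u_ge0 ux] := cone_separation clG G0 GD GZ Gx.
pose f : 'Hom(tensor X (sob S d), R^o) := linfun (dot u : _ -> R^o).
have fE y : f y = dot u y by apply: linfE; exact: dot_linear.
(* The identity of [d] tests [f] at [x] itself, where it is negative. *)
suff /(_ (idm d)) : level (cogen_system f) d x.
  rewrite (_ : tmap _ _ = \1%VF) ?id_lfunE ?fE; first by rewrite leNgt ux.
  by apply: tensor_ext => y v; rewrite tmapE !id_lfunE smor_id.
apply: Hx; split; first exact/realizable_hedron/cogen_realizable.
by move=> c y Gy Phi; rewrite fE; apply: u_ge0; apply: level_mor; exists y.
Qed.
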